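(* Consider the complex 3-dimensional Novikov algebras $C_1$, $C_2$, $C_3$, $C_4$, $C_5(\alpha)$ $(\alpha\in\mathbb{C})$, $C_6(\beta)$ $(\beta\in\mathbb{C})$, $C_7(\gamma)$ $(\gamma\in\mathbb{C}\setminus\{0\})$ and $B_1$, $B_2$, $B_3$, $B_4(\alpha)$ $(\alpha\in\mathbb{C})$, $B_5(\beta)$ $(\beta\in\mathbb{C})$ given by the products listed in the context. For $A$ in the first list (type $C$) and $B$ in the second list (type $B$), $B$ lies in $\partial O(A)$ if and only if $B$ is isomorphic to one of the algebras given for $A$ below: \begin{itemize} \item $A=C_1$: $B_3$, and $B_4(\alpha)$, $B_5(\alpha)$ for all $\alpha\in\mathbb{C}$; \item $A=C_2$: $B_4(0)$, $B_5(0)$; \item $A=C_3$: $B_4(1)$, $B_5(0)$; \item $A=C_4$: $B_4(0)$, $B_5(0)$; \item $A=C_5(\alpha)$ with $\alpha\neq0,-\tfrac12,-1$: $B_4(-\alpha)$, $B_5(-\alpha)$; \item $A=C_5(0)$: $B_5(0)$; \item $A=C_5(-\tfrac12)$: $B_3$, $B_4(\tfrac12)$, $B_5(\tfrac12)$; \item $A=C_5(-1)$: $B_5(0)$; \item $A=C_6(\beta)$ with $\beta\neq-1$: $B_3$, and $B_4(\alpha)$, $B_5(\alpha)$ for all $\alpha\in\mathbb{C}$; \item $A=C_6(-1)$: $B_5(0)$; \item $A=C_7(\gamma)$ with $\gamma\neq0,-1$: $B_4(0)$, $B_5(0)$; \item $A=C_7(-1)$: $B_5(0)$. \end{itemize}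
   Context: A Novikov algebra over $\mathbb{C}$ is a complex vector space with a bilinear product satisfying $(x\cdot y)\cdot z-x\cdot(y\cdot z)=(y\cdot x)\cdot z-y\cdot(x\cdot z)$ and $(x\cdot y)\cdot z=(x\cdot z)\cdot y$ for all $x,y,z$. Fix a 3-dimensional complex vector space $V$ with basis $(e_1,e_2,e_3)$. The set of Novikov products on $V$, identified with their structure constants in $\mathbb{C}^{27}$, is an affine algebraic set, on which $GL_3(\mathbb{C})$ acts by $(g\circ\mu)(x,y)=g(\mu(g^{-1}x,g^{-1}y))$. For a 3-dimensional Novikov algebra $A$, $O(A)$ is the orbit of a structure representing $A$, $\overline{O(A)}$ its Zariski closure, and $\partial O(A)=\overline{O(A)}\setminus O(A)$; ''$B$ lies in $\partial O(A)$'' means that a structure representing $B$ lies in $\partial O(A)$. The algebras (basis $e_1,e_2,e_3$; products of basis vectors not listed are zero): $C_1$: $e_1e_1=-e_1+e_2$, $e_2e_1=-e_2$, $e_3e_3=e_3$. $C_2$: $e_1e_1=-e_1+e_2$, $e_1e_3=-e_3$, $e_2e_1=-e_2$, $e_3e_1=-e_3$. $C_3$: $e_1e_1=-e_1+e_2$, $e_2e_1=-e_2$. $C_4$: $e_1e_1=e_3$, $e_1e_2=e_2$. $C_5(\alpha)$: $e_1e_1=\alpha e_1$, $e_1e_2=(\alpha+1)e_2$, $e_2e_1=\alpha e_2$. $C_6(\beta)$: $e_1e_1=\beta e_1$, $e_1e_2=(\beta+1)e_2$, $e_2e_1=\beta e_2$, $e_3e_3=e_3$. $C_7(\gamma)$,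 $\gamma\ne0$: $e_1e_1=\gamma e_1$, $e_1e_2=(\gamma+1)e_2$, $e_1e_3=\gamma e_3$, $e_2e_1=\gamma e_2$, $e_3e_1=\gamma e_3$. $B_1$: $e_1e_1=e_1$, $e_1e_2=e_2+e_3$, $e_1e_3=e_3$, $e_2e_1=e_2$, $e_3e_1=e_3$. $B_2$: $e_1e_1=e_1$, $e_1e_2=e_2+e_3$, $e_1e_3=e_3$, $e_2e_1=e_2$, $e_2e_2=e_3$, $e_3e_1=e_3$. $B_3$: $e_1e_2=\frac12e_3$, $e_2e_1=-\frac12e_3$, $e_2e_2=e_3$. $B_4(\alpha)$: $e_1e_2=\alpha e_3$, $e_2e_1=(\alpha-1)e_3$, $e_2e_2=e_1$. $B_5(\beta)$: $e_1e_2=\beta e_3$, $e_2e_1=(\beta-1)e_3$. The only isomorphisms among these algebras are $B_5(\beta)\cong B_5(1-\beta)$. *)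

(* Defs.v *)
From mathcomp Require Import all_boot all_order all_algebra.
From mathcomp Require Import mpoly ring.

Set Implicit Arguments.
Unset Strict Implicit.
Unset Printing Implicit Defensive.

Import GRing.Theory.
Local Open Scope ring_scope.

(* The 27 indices (i, j, k) of the structure constants; (i, j, k) is attached
   to the coefficient of e_(k+1) in e_(i+1) e_(j+1). *)
Notation idx3 := ('I_3 * 'I_3 * 'I_3)%type.

(* Bilinear products on K^3, identified with their structure constants. *)
Notation product3 K := {ffun idx3 -> K}.

Definition mul (K : fieldType) (mu : product3 K) (x y : 'cV[K]_3) : 'cV[K]_3 :=
  \col_k \sum_(i < 3) \sum_(j < 3) x i 0 * y j 0 * mu (i, j, k).

Definition is_novikov (K : fieldType) (mu : product3 K) : Prop :=
  forall x y z : 'cV[K]_3,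
    mul mu (mul mu x y) z - mul mu x (mul mu y z)
      = mul mu (mul mu y x) z - mul mu y (mul mu x z)
    /\ mul mu (mul mu x y) z = mul mu (mul mu x z) y.

Definition basis3 (K : fieldType) (i : 'I_3) : 'cV[K]_3 := delta_mx i 0.

(* Meant for bilinear f. *)
Definition structure_constants (K : fieldType)
    (f : 'cV[K]_3 -> 'cV[K]_3 -> 'cV[K]_3) : product3 K :=
  [ffun t : idx3 => f (basis3 K t.1.1) (basis3 K t.1.2) t.2 0].

Definition GL_act (K : fieldType) (g : 'M[K]_3) (mu : product3 K) : product3 K :=
  structure_constants
    (fun x y => g *m mul mu (invmx g *m x) (invmx g *m y)).

Definition orbit3 (K : fieldType) (mu nu : product3 K) : Prop :=
  exists2 g : 'M[K]_3, g \in unitmx & nu = GL_act g mu.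

Definition zariski_closure (K : fieldType) (S : product3 K -> Prop)
    (nu : product3 K) : Prop :=
  forall p : {mpoly K[#|{: idx3}|]},
    (forall mu, S mu -> p.@[fun i => mu (enum_val i)] = 0) ->
    p.@[fun i => nu (enum_val i)] = 0.

Definition orbit_boundary (K : fieldType) (mu nu : product3 K) : Prop :=
  zariski_closure (orbit3 mu) nu /\ ~ orbit3 mu nu.

Definition isomorphic (K : fieldType) (mu nu : product3 K) : Prop :=
  exists2 g : 'M[K]_3, g \in unitmx &
    forall x y, g *m mul mu x y = mul nu (g *m x) (g *m y).

(* The algebra nu is represented by some structure in the boundary of the
   orbit of mu. *)
Definition lies_in_boundary (K : fieldType) (nu mu : product3 K) : Prop :=
  exists2 nu', isomorphic nu' nu & orbit_boundary mu nu'.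

Inductive typeC (K : fieldType) : Type :=
  | C1 | C2 | C3 | C4
  | C5 (alpha : K)
  | C6 (beta : K)
  | C7 (gamma : K) (gamma_neq0 : gamma != 0).

Inductive typeB (K : fieldType) : Type :=
  | B1 | B2 | B3
  | B4 (alpha : K)
  | B5 (beta : K).

Arguments C1 {K}. Arguments C2 {K}. Arguments C3 {K}. Arguments C4 {K}.
Arguments B1 {K}. Arguments B2 {K}. Arguments B3 {K}.

(* The product with e_i e_j = f i j, where i and j range over 1, 2, 3. *)
Definition from_table (K : fieldType) (f : nat -> nat -> 'cV[K]_3) : product3 K :=
  [ffun t : idx3 => f t.1.1.+1 t.1.2.+1 t.2 0].

Definition structC (K : fieldType) (A : typeC K) : product3 K :=
  let e1 := basis3 K (@Ordinal 3 0 isT) in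
  let e2 := basis3 K (@Ordinal 3 1 isT) in
  let e3 := basis3 K (@Ordinal 3 2 isT) in
  from_table (fun i j =>
    match A, i, j with
    | C1, 1%N, 1%N => - e1 + e2
    | C1, 2%N, 1%N => - e2
    | C1, 3%N, 3%N => e3

    | C2, 1%N, 1%N => - e1 + e2
    | C2, 1%N, 3%N => - e3
    | C2, 2%N, 1%N => - e2
    | C2, 3%N, 1%N => - e3

    | C3, 1%N, 1%N => - e1 + e2
    | C3, 2%N, 1%N => - e2

    | C4, 1%N, 1%N => e3
    | C4, 1%N, 2%N => e2

    | C5 a, 1%N, 1%N => a *: e1
    | C5 a, 1%N, 2%N => (a + 1) *: e2
    | C5 a, 2%N, 1%N => a *: e2

    | C6 b, 1%N, 1%N => b *: e1
    | C6 b, 1%N, 2%N => (b + 1) *: e2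
    | C6 b, 2%N, 1%N => b *: e2
    | C6 b, 3%N, 3%N => e3

    | C7 c _, 1%N, 1%N => c *: e1
    | C7 c _, 1%N, 2%N => (c + 1) *: e2
    | C7 c _, 1%N, 3%N => c *: e3
    | C7 c _, 2%N, 1%N => c *: e2
    | C7 c _, 3%N, 1%N => c *: e3

    | _, _, _ => 0
    end).

Definition structB (K : fieldType) (B : typeB K) : product3 K :=
  let e1 := basis3 K (@Ordinal 3 0 isT) in
  let e2 := basis3 K (@Ordinal 3 1 isT) in
  let e3 := basis3 K (@Ordinal 3 2 isT) in
  from_table (fun i j =>
    match B, i, j with
    | B1, 1%N, 1%N => e1
    | B1, 1%N, 2%N => e2 + e3
    | B1, 1%N, 3%N => e3
    | B1, 2%N, 1%N => e2
    | B1, 3%N, 1%N => e3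

    | B2, 1%N, 1%N => e1
    | B2, 1%N, 2%N => e2 + e3
    | B2, 1%N, 3%N => e3
    | B2, 2%N, 1%N => e2
    | B2, 2%N, 2%N => e3
    | B2, 3%N, 1%N => e3

    | B3, 1%N, 2%N => (1 / 2) *: e3
    | B3, 2%N, 1%N => - (1 / 2) *: e3
    | B3, 2%N, 2%N => e3

    | B4 a, 1%N, 2%N => a *: e3
    | B4 a, 2%N, 1%N => (a - 1) *: e3
    | B4 a, 2%N, 2%N => e1

    | B5 b, 1%N, 2%N => b *: e3
    | B5 b, 2%N, 1%N => (b - 1) *: e3

    | _, _, _ => 0
    end).

Inductive listed (K : fieldType) : typeC K -> typeB K -> Prop :=
  | C1_B3 : listed C1 B3
  | C1_B4 a : listed C1 (B4 a)
  | C1_B5 a : listed C1 (B5 a)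

  | C2_B4 : listed C2 (B4 0)
  | C2_B5 : listed C2 (B5 0)

  | C3_B4 : listed C3 (B4 1)
  | C3_B5 : listed C3 (B5 0)

  | C4_B4 : listed C4 (B4 0)
  | C4_B5 : listed C4 (B5 0)

  | C5_B4 a : a != 0 -> a != - (1 / 2) -> a != -1 -> listed (C5 a) (B4 (- a))
  | C5_B5 a : a != 0 -> a != - (1 / 2) -> a != -1 -> listed (C5 a) (B5 (- a))
  | C5_0_B5 : listed (C5 0) (B5 0)
  | C5_Nhalf_B3 : listed (C5 (- (1 / 2))) B3
  | C5_Nhalf_B4 : listed (C5 (- (1 / 2))) (B4 (1 / 2))
  | C5_Nhalf_B5 : listed (C5 (- (1 / 2))) (B5 (1 / 2))
  | C5_N1_B5 : listed (C5 (-1)) (B5 0)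

  | C6_B3 b : b != -1 -> listed (C6 b) B3
  | C6_B4 b a : b != -1 -> listed (C6 b) (B4 a)
  | C6_B5 b a : b != -1 -> listed (C6 b) (B5 a)
  | C6_N1_B5 : listed (C6 (-1)) (B5 0)

  | C7_B4 c (c_neq0 : c != 0) : c != -1 -> listed (C7 c_neq0) (B4 0)
  | C7_B5 c (c_neq0 : c != 0) : c != -1 -> listed (C7 c_neq0) (B5 0)
  | C7_N1_B5 (N1_neq0 : -1 != 0) : listed (C7 N1_neq0) (B5 0).

Lemma mul_from_table (K : fieldType) (f : nat -> nat -> 'cV[K]_3) (i j : 'I_3) :
  mul (from_table f) (basis3 K i) (basis3 K j) = f i.+1 j.+1.
Proof.
apply/colP=> k; rewrite mxE (bigD1 i) //= [X in _ + X]big1 => [|i' ne_i'i].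
  rewrite addr0 (bigD1 j) //= [X in _ + X]big1 => [|j' ne_j'j].
    by rewrite addr0 !mxE !eqxx ffunE /= !mul1r.
  by rewrite !mxE (negPf ne_j'j) /= mulr0 mul0r.
by rewrite big1 // => j' _; rewrite !mxE (negPf ne_i'i) /= !mul0r.
Qed.

Lemma mul_coord (K : fieldType) (mu : product3 K) (x y : 'cV[K]_3) (k : 'I_3) :
  let i1 := @Ordinal 3 0 isT in
  let i2 := @Ordinal 3 1 isT in
  let i3 := @Ordinal 3 2 isT in
  mul mu x y k 0 =
      x i1 0 * y i1 0 * mu (i1, i1, k) + x i1 0 * y i2 0 * mu (i1, i2, k)
    + x i1 0 * y i3 0 * mu (i1, i3, k) + x i2 0 * y i1 0 * mu (i2, i1, k)
    + x i2 0 * y i2 0 * mu (i2, i2, k) + x i2 0 * y i3 0 * mu (i2, i3, k)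
    + x i3 0 * y i1 0 * mu (i3, i1, k) + x i3 0 * y i2 0 * mu (i3, i2, k)
    + x i3 0 * y i3 0 * mu (i3, i3, k).
Proof.
have lift1 : lift ord0 ord0 = @Ordinal 3 1 isT by apply: val_inj.
have lift2 : lift ord0 (lift ord0 ord0) = @Ordinal 3 2 isT by apply: val_inj.
have lift0 : ord0 = @Ordinal 3 0 isT by apply: val_inj.
by rewrite mxE !big_ord_recl !big_ord0 lift2 lift1 lift0 !addr0 !addrA.
Qed.

Lemma ord3P (k : 'I_3) :
  [\/ k = @Ordinal 3 0 isT, k = @Ordinal 3 1 isT | k = @Ordinal 3 2 isT].
Proof.
by case: k => -[|[|[|//]]] ltk3; [constructor 1|constructor 2|constructor 3];
  apply: val_inj.
Qed.

Lemma sub_coord (K : fieldType) (u v : 'cV[K]_3) (k : 'I_3) :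
  (u - v) k 0 = u k 0 - v k 0.
Proof. by rewrite !mxE. Qed.

Ltac compute_coordinate mu p :=
  intros; rewrite mul_coord /mu !ffunE /= !mxE /=;
  rewrite !(oppr0, mulr0, addr0, add0r) /p; reflexivity.

Ltac novikov_by_coordinates K mu :=
  let p1 := fresh "p" in let p2 := fresh "p" in let p3 := fresh "p" in
  let E1 := fresh "E" in let E2 := fresh "E" in let E3 := fresh "E" in
  let k := fresh "k" in
  evar (p1 : 'cV[K]_3 -> 'cV[K]_3 -> K);
  evar (p2 : 'cV[K]_3 -> 'cV[K]_3 -> K);
  evar (p3 : 'cV[K]_3 -> 'cV[K]_3 -> K);
  assert (E1 : forall x y, mul mu x y (@Ordinal 3 0 isT) 0 = p1 x y)
    by compute_coordinate mu p1;
  assert (E2 : forall x y, mul mu x y (@Ordinal 3 1 isT) 0 = p2 x y)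
    by compute_coordinate mu p2;
  assert (E3 : forall x y, mul mu x y (@Ordinal 3 2 isT) 0 = p3 x y)
    by compute_coordinate mu p3;
  clearbody mu;
  intros ? ? ?; split; apply/colP; intro k; case: (ord3P k) => ->;
  rewrite ?sub_coord ?E1 ?E2 ?E3 /p1 /p2 /p3;
  rewrite ?E1 ?E2 ?E3 /p1 /p2 /p3; ring.

Lemma structC_novikov (K : fieldType) (A : typeC K) :
  is_novikov (structC A).
Proof. by case: A => [||||a|b|c c_neq0]; set mu := structC _; novikov_by_coordinates K mu. Qed.

Lemma structB_novikov (K : fieldType) (B : typeB K) :
  is_novikov (structB B).
Proof. by case: B => [|||a|b]; set mu := structB _; novikov_by_coordinates K mu. Qed.

(* Main.v *)
From mathcomp Require Import all_boot all_order all_algebra.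
From mathcomp Require Import reals complex mpoly.
From mathcomp Require Import ring.
Require Import Defs.

Set Implicit Arguments.
Unset Strict Implicit.
Unset Printing Implicit Defensive.

Import GRing.Theory Num.Theory.
Local Open Scope ring_scope.

(** For an algebra A of either list put tau(y) = tr L_y - tr R_y, where L_y and
R_y are left and right multiplication by y. On type C, tau is the first
coordinate; on type B it vanishes. So no algebra of type C is isomorphic to one
of type B, and the boundary may be replaced by the closure of the orbit.

Degenerations. If weights w_i satisfy w_k <= w_i + w_j whenever e_k occurs in
e_i e_j, rescaling e_i by t^(w_i) and letting t tend to 0 keeps exactly the
terms with equality (initial_part_closure). Two choices of weights suffice.
- Weights (1, 1, 2). For a plane P spanned by u and v, the product of A induces
  a bilinear form on P with values in the line A/P, and A degenerates to the
  nilpotent algebra defined by this form (form_closure). B3 and B5(b) are such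
  form algebras.
- Weights (2, 1, 3). If x, x^2 and [x^2, x] form a basis, A degenerates to
  B4(a), where a and a - 1 are read off the coordinates of x^2 x and x x^2 on
  the third vector (B4_closure).
In C1, and in C6(b) for b != -1, the parameter a so obtained varies with x and
misses only finitely many values; these are limits of the others. B4(a)
degenerates to B5(a), and B4(1/2) to B3, by the first construction.

Obstructions. Three families of polynomial conditions, each invariant under
isomorphism, hence inherited by the closure of an orbit, exclude all the
other pairs.
- The eigenvalue condition: c tau(y) is an eigenvalue of R_y for all y. Every
  algebra of type C satisfies it for some c. It fails for B1 and B2, which have
  a right unit e although tau(e) = 0.
- The discriminant condition: for the form phi induced on a plane P by the
  product, phi(x,x) phi(y,y) - phi(x,y) phi(y,x) is d times the square of
  phi(x,y) - phi(y,x). The ratio d of the determinant of a form to the square of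
  its alternating part does not depend on the basis; for the plane of e_1 and
  e_2 it is 1/4 in B3 and b (1 - b) in both B4(b) and B5(b). For all planes d is
  - a (a + 1) in C5(a), and 0 in C2, C3, C4, C6(-1) and C7, because phi there is
  a product of two linear forms.
- The cubic condition: s x^2 x + t x x^2 lies in the span of x and x^2 whenever
  these are independent. In B4(a) it says s a + t (a - 1) = 0, which separates
  B4(b) from B4(1 - b). *)

(** * Coordinates *)

Notation i1 := (@Ordinal 3 0 isT).
Notation i2 := (@Ordinal 3 1 isT).
Notation i3 := (@Ordinal 3 2 isT).

Definition col3 (K : fieldType) (a b c : K) : 'cV[K]_3 :=
  \col_(k < 3) nth 0 [:: a; b; c] k.

Definition frame (K : fieldType) (u v w : 'cV[K]_3) : 'M[K]_3 :=
  \matrix_(k, i) (nth 0 [:: u; v; w] i) k 0.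

Lemma big_ord3 (V : zmodType) (F : 'I_3 -> V) :
  \sum_(i < 3) F i = F i1 + F i2 + F i3.
Proof.
by rewrite !big_ord_recr big_ord0 /= add0r; congr (F _ + F _ + F _);
  apply: val_inj.
Qed.

Lemma col3_eta (K : fieldType) (x : 'cV[K]_3) :
  x = col3 (x i1 0) (x i2 0) (x i3 0).
Proof. by apply/colP=> k; rewrite mxE; case: (ord3P k) => ->. Qed.

Lemma det3 (K : fieldType) (M : 'M[K]_3) :
  \det M = M i1 i1 * (M i2 i2 * M i3 i3 - M i2 i3 * M i3 i2)
         - M i1 i2 * (M i2 i1 * M i3 i3 - M i2 i3 * M i3 i1)
         + M i1 i3 * (M i2 i1 * M i3 i2 - M i2 i2 * M i3 i1).
Proof.
have [m Mm] : exists m : nat -> nat -> K, forall i j : 'I_3, M i j = m i j.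
  by exists (fun a b => M (inord a) (inord b)) => i j; rewrite !inord_val.
rewrite !Mm /= (expand_det_row _ i1) big_ord3 /cofactor.
rewrite !(expand_det_row _ ord0) !big_ord_recl !big_ord0 /cofactor !det_mx11.
by rewrite !mxE !Mm /= /bump /=; ring.
Qed.

(** * Multiplication operators and changes of basis *)

Definition Lmx (K : fieldType) (mu : product3 K) (x : 'cV[K]_3) : 'M[K]_3 :=
  \matrix_(k, j) mul mu x (basis3 K j) k 0.

Definition Rmx (K : fieldType) (mu : product3 K) (y : 'cV[K]_3) : 'M[K]_3 :=
  \matrix_(k, i) mul mu (basis3 K i) y k 0.

Lemma mul_basisl (K : fieldType) (mu : product3 K) (i : 'I_3) y k :
  mul mu (basis3 K i) y k 0 = \sum_j y j 0 * mu (i, j, k).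
Proof.
rewrite mxE (bigD1 i) //= [X in _ + X]big1 ?addr0 => [|a ne_ai]; last first.
  by rewrite big1 // => j _; rewrite mxE (negPf ne_ai) !mul0r.
by apply: eq_bigr => j _; rewrite mxE !eqxx mul1r.
Qed.

Lemma mul_basisr (K : fieldType) (mu : product3 K) (j : 'I_3) x k :
  mul mu x (basis3 K j) k 0 = \sum_i x i 0 * mu (i, j, k).
Proof.
rewrite mxE; apply: eq_bigr => i _.
rewrite (bigD1 j) //= [X in _ + X]big1 ?addr0 => [|a ne_aj]; last first.
  by rewrite [basis3 _ _ _ _]mxE (negPf ne_aj) mulr0 mul0r.
by rewrite [basis3 _ _ _ _]mxE !eqxx mulr1.
Qed.

Lemma mul_basis (K : fieldType) (mu : product3 K) (i j k : 'I_3) :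
  mul mu (basis3 K i) (basis3 K j) k 0 = mu (i, j, k).
Proof.
rewrite mul_basisl (bigD1 j) //= [X in _ + X]big1 ?addr0 => [|a ne_aj];
  last first.
  by rewrite mxE (negPf ne_aj) mul0r.
by rewrite mxE !eqxx mul1r.
Qed.

Lemma Rmx_mul (K : fieldType) (mu : product3 K) (x y : 'cV[K]_3) :
  Rmx mu y *m x = mul mu x y.
Proof.
apply/colP=> k; rewrite !mxE; apply: eq_bigr => i _.
rewrite mxE mul_basisl mulr_suml; apply: eq_bigr => j _.
by rewrite mulrC mulrA.
Qed.

Lemma Lmx_mul (K : fieldType) (mu : product3 K) (x y : 'cV[K]_3) :
  Lmx mu x *m y = mul mu x y.
Proof.
apply/colP=> k; rewrite !mxE exchange_big /=; apply: eq_bigr => j _.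
rewrite mxE mul_basisr mulr_suml; apply: eq_bigr => i _.
by rewrite mulrAC.
Qed.

Lemma mulmx_basis (K : fieldType) (M : 'M[K]_3) (k i : 'I_3) :
  (M *m basis3 K i) k 0 = M k i.
Proof. by rewrite -colE mxE. Qed.

Lemma cV_basis (K : fieldType) (x : 'cV[K]_3) :
  x = \sum_i x i 0 *: basis3 K i.
Proof.
apply/colP=> k; rewrite summxE (bigD1 k) //= big1 => [|i ne_ik].
  by rewrite !mxE !eqxx mulr1 addr0.
by rewrite !mxE eq_sym (negPf ne_ik) mulr0.
Qed.

Lemma mul_GL_act (K : fieldType) (g : 'M[K]_3) (mu : product3 K) x y :
  mul (GL_act g mu) x y = g *m mul mu (invmx g *m x) (invmx g *m y).
Proof.
rewrite -Rmx_mul -(Rmx_mul mu) !mulmxA [in LHS](cV_basis x) [in RHS](cV_basis x).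
rewrite !mulmx_sumr; apply: eq_bigr => i _; rewrite -!scalemxAr; congr (_ *: _).
rewrite Rmx_mul -(mulmxA (g *m _)) -(mulmxA g) Rmx_mul -Lmx_mul -(Lmx_mul mu).
rewrite !mulmxA [in LHS](cV_basis y) [in RHS](cV_basis y).
rewrite !mulmx_sumr; apply: eq_bigr => j _; rewrite -!scalemxAr; congr (_ *: _).
rewrite Lmx_mul -(mulmxA (g *m _)) -(mulmxA g) Lmx_mul.
by apply/colP=> k; rewrite mul_basis ffunE.
Qed.

Lemma product3_ext (K : fieldType) (mu nu : product3 K) :
  (forall x y, mul mu x y = mul nu x y) -> mu = nu.
Proof.
by move=> eq_mul; apply/ffunP=> -[[i j] k]; rewrite -!mul_basis eq_mul.
Qed.

Lemma orbit3P (K : fieldType) (mu nu : product3 K) :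
  orbit3 mu nu <-> isomorphic mu nu.
Proof.
split=> -[g g_unit gP]; exists g => //.
  by move=> x y; rewrite gP mul_GL_act !mulKmx.
by apply: product3_ext => x y; rewrite mul_GL_act gP !mulKVmx.
Qed.

Lemma isomorphic_refl (K : fieldType) (mu : product3 K) : isomorphic mu mu.
Proof. by exists 1%:M; rewrite ?unitmx1 // => x y; rewrite !mul1mx. Qed.

Lemma isomorphic_sym (K : fieldType) (mu nu : product3 K) :
  isomorphic mu nu -> isomorphic nu mu.
Proof.
move=> [g g_unit gP]; exists (invmx g); rewrite ?unitmx_inv // => x y.
by rewrite -[LHS](mulKmx g_unit) mulKVmx // -{1}(mulKVmx g_unit x)
           -{1}(mulKVmx g_unit y) -gP mulKmx.
Qed.

Lemma isomorphic_trans (K : fieldType) (mu nu rho : product3 K) :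
  isomorphic mu nu -> isomorphic nu rho -> isomorphic mu rho.
Proof.
move=> [g g_unit gP] [h h_unit hP]; exists (h *m g) => [|x y].
  by rewrite unitmx_mul h_unit.
by rewrite -!mulmxA gP hP.
Qed.

Lemma mul_iso (K : fieldType) (g : 'M[K]_3) (mu nu : product3 K) x y :
  g \in unitmx -> (forall x y, g *m mul mu x y = mul nu (g *m x) (g *m y)) ->
  mul nu x y = g *m mul mu (invmx g *m x) (invmx g *m y).
Proof. by move=> g_unit ->; rewrite !mulKVmx. Qed.

(** * Polynomial functions and the Zariski closure of an orbit *)

(** The semantic form of being given by a polynomial: it is preserved by the
operations used to build invariants, without handling formal polynomials. *)
Definition polynomial_function (K : fieldType) (f : product3 K -> K) :=
  exists p : {mpoly K[#|{: idx3}|]},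
    forall mu, f mu = p.@[fun i => mu (enum_val i)].

Definition polynomial_vector (K : fieldType) (F : product3 K -> 'cV[K]_3) :=
  forall k, polynomial_function (fun mu => F mu k 0).

Lemma pf_const (K : fieldType) (c : K) : polynomial_function (fun=> c).
Proof. by exists c%:MP => mu; rewrite mevalC. Qed.

Lemma pf_coord (K : fieldType) (t : idx3) :
  polynomial_function (fun mu : product3 K => mu t).
Proof. by exists 'X_(enum_rank t) => mu; rewrite mevalXU enum_rankK. Qed.

Lemma pf_add (K : fieldType) (f g : product3 K -> K) :
  polynomial_function f -> polynomial_function g ->
  polynomial_function (fun mu => f mu + g mu).
Proof. by move=> [p fp] [q gq]; exists (p + q) => mu; rewrite mevalD fp gq. Qed.

Lemma pf_mul (K : fieldType) (f g : product3 K -> K) :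
  polynomial_function f -> polynomial_function g ->
  polynomial_function (fun mu => f mu * g mu).
Proof. by move=> [p fp] [q gq]; exists (p * q) => mu; rewrite mevalM fp gq. Qed.

Lemma pf_opp (K : fieldType) (f : product3 K -> K) :
  polynomial_function f -> polynomial_function (fun mu => - f mu).
Proof. by move=> [p fp]; exists (- p) => mu; rewrite mevalN fp. Qed.

Lemma pf_ext (K : fieldType) (f g : product3 K -> K) :
  polynomial_function f -> f =1 g -> polynomial_function g.
Proof. by move=> [p fp] eq_fg; exists p => mu; rewrite -eq_fg. Qed.

Lemma pf_sum (K : fieldType) (I : finType) (F : I -> product3 K -> K) :
  (forall i, polynomial_function (F i)) ->
  polynomial_function (fun mu => \sum_i F i mu).
Proof.
move=> polF; elim: index_enum => [|i s IHs].
  by apply: pf_ext (pf_const 0) _ => mu; rewrite big_nil.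
by apply: pf_ext (pf_add (polF i) IHs) _ => mu; rewrite big_cons.
Qed.

Lemma pf_prod (K : fieldType) (I : finType) (F : I -> product3 K -> K) :
  (forall i, polynomial_function (F i)) ->
  polynomial_function (fun mu => \prod_i F i mu).
Proof.
move=> polF; elim: index_enum => [|i s IHs].
  by apply: pf_ext (pf_const 1) _ => mu; rewrite big_nil.
by apply: pf_ext (pf_mul (polF i) IHs) _ => mu; rewrite big_cons.
Qed.

Lemma pf_det (K : fieldType) (M : product3 K -> 'M[K]_3) :
  (forall i j, polynomial_function (fun mu => M mu i j)) ->
  polynomial_function (fun mu => \det (M mu)).
Proof.
move=> polM; apply: pf_sum => s; apply: pf_mul; first exact: pf_const.
by apply: pf_prod => i.
Qed.

Lemma pv_const (K : fieldType) (x : 'cV[K]_3) : polynomial_vector (fun=> x).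
Proof. by move=> k; apply: pf_const. Qed.

Lemma pv_add (K : fieldType) (F G : product3 K -> 'cV[K]_3) :
  polynomial_vector F -> polynomial_vector G ->
  polynomial_vector (fun mu => F mu + G mu).
Proof.
by move=> polF polG k; apply: pf_ext (pf_add (polF k) (polG k)) _ => mu; rewrite mxE.
Qed.

Lemma pv_mulmx (K : fieldType) m (A : 'M[K]_(m, 3)) (F : product3 K -> 'cV[K]_3) :
  polynomial_vector F ->
  forall i, polynomial_function (fun mu => (A *m F mu) i 0).
Proof.
move=> polF i; pose f j (mu : product3 K) := A i j * F mu j 0.
apply: (@pf_ext _ (fun mu => \sum_j f j mu)) => [|mu]; last by rewrite mxE.
by apply: pf_sum => j; apply: pf_mul => //; apply: pf_const.
Qed.

Lemma pv_scale (K : fieldType) c (F : product3 K -> 'cV[K]_3) :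
  polynomial_vector F -> polynomial_vector (fun mu => c *: F mu).
Proof.
by move=> polF k; apply: pf_ext (pf_mul (pf_const c) (polF k)) _ => mu; rewrite mxE.
Qed.

Lemma pv_mul (K : fieldType) (F G : product3 K -> 'cV[K]_3) :
  polynomial_vector F -> polynomial_vector G ->
  polynomial_vector (fun mu => mul mu (F mu) (G mu)).
Proof.
move=> polF polG k.
pose f i j (mu : product3 K) := F mu i 0 * G mu j 0 * mu (i, j, k).
apply: (@pf_ext _ (fun mu => \sum_i \sum_j f i j mu)) => [|mu]; last by rewrite mxE.
apply: pf_sum => i; apply: pf_sum => j.
by do 2?[apply: pf_mul]; last exact: pf_coord.
Qed.

Lemma closure_sub (K : fieldType) (S : product3 K -> Prop) mu :
  S mu -> zariski_closure S mu.
Proof. by move=> S_mu p; apply. Qed.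

Lemma closure_polynomial_zero (K : fieldType) (S : product3 K -> Prop) nu f :
  zariski_closure S nu -> polynomial_function f ->
  (forall mu, S mu -> f mu = 0) -> f nu = 0.
Proof. by move=> S_nu [p fp] f0; rewrite fp; apply: S_nu => mu /f0; rewrite fp. Qed.

(** The action of g is polynomial in the structure constants and preserves the
orbit of mu. So if a polynomial vanishes on this orbit, its composite with the
action of g does too, and the polynomial vanishes at the image of nu by g. *)
Lemma closure_orbit_trans (K : fieldType) (mu nu rho : product3 K) :
  zariski_closure (orbit3 mu) nu -> zariski_closure (orbit3 nu) rho ->
  zariski_closure (orbit3 mu) rho.
Proof.
move=> mu_nu nu_rho p p0; apply: nu_rho => sigma [g g_unit ->].
pose f (rho : product3 K) := p.@[fun i => GL_act g rho (enum_val i)].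
apply: (@closure_polynomial_zero _ _ _ f mu_nu) => [|rho' [h h_unit ->]]; last first.
  apply: p0; apply/orbit3P; apply: (@isomorphic_trans _ _ (GL_act h mu));
    apply/orbit3P; first by exists h.
  by exists g.
(* The 27 coordinates of GL_act g are substituted for the variables of p. *)
have polG t : polynomial_function (fun mu => GL_act g mu t).
  case: t => [[i j] k].
  apply: (@pf_ext _ (fun mu => (g *m mul mu (invmx g *m basis3 K i)
                                            (invmx g *m basis3 K j)) k 0)).
    by apply: pv_mulmx; apply: pv_mul; apply: pv_const.
  by move=> mu'; rewrite ffunE.
have [q qP] : exists q : 'I_#|{: idx3}| -> {mpoly K[#|{: idx3}|]},
    forall i mu, GL_act g mu (enum_val i) = (q i).@[fun i => mu (enum_val i)].
  exact: (fin_all_exists (fun i => polG (enum_val i))).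
exists (p \mPo [tuple q i | i < #|{: idx3}|]) => mu'.
rewrite comp_mpoly_meval; apply: meval_eq => i.
by rewrite qP tnth_mktuple.
Qed.

Lemma closure_iso (K : fieldType) (mu nu rho : product3 K) :
  zariski_closure (orbit3 mu) nu -> isomorphic nu rho ->
  zariski_closure (orbit3 mu) rho.
Proof.
move=> mu_nu /orbit3P nu_rho; apply: closure_orbit_trans mu_nu _.
exact: closure_sub.
Qed.

(** Multiplying by the factors X - a for the exceptional a gives a polynomial
that vanishes on all of K, in particular at every natural number. *)
Lemma poly_infinite_roots (K : numFieldType) (p : {poly K}) (s : seq K) :
  (forall t, t \notin s -> p.[t] = 0) -> p = 0.
Proof.
move=> p0; pose q := p * \prod_(a <- s) ('X - a%:P).
have q0 t : q.[t] = 0.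
  rewrite hornerM; have [t_s|/p0->] := boolP (t \in s); last by rewrite mul0r.
  by rewrite horner_prod (big_rem _ t_s) /= hornerXsubC subrr mul0r mulr0.
suff /eqP : q = 0.
  rewrite mulf_eq0 => /orP[/eqP//|/eqP/(congr1 lead_coef)].
  by rewrite lead_coef0 => /eqP; rewrite (monicP _) ?oner_eq0 // monic_prod_XsubC.
apply/eqP/negP => /negP q_neq0.
have := @max_poly_roots _ q [seq i%:R | i <- iota 0 (size q)] q_neq0.
rewrite size_map size_iota ltnn => no_roots; suff: false by [].
apply: no_roots; first by apply/allP=> t _; rewrite rootE q0.
by rewrite map_inj_uniq ?iota_uniq // => i j /eqP; rewrite eqr_nat => /eqP.
Qed.

(** A polynomial that vanishes on S pulls back along the curve to a polynomial
in one variable with infinitely many roots. *)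
Lemma closure_curve (K : numFieldType) (S : product3 K -> Prop)
    (nu : K -> product3 K) (c : idx3 -> {poly K}) (s : seq K) (t : K) :
  (forall t i, nu t i = (c i).[t]) ->
  (forall t, t \notin s -> zariski_closure S (nu t)) ->
  zariski_closure S (nu t).
Proof.
move=> nuE S_nu p p0.
pose q := \sum_(m <- msupp p) p@_m *: \prod_i c (enum_val i) ^+ m i.
have pE u : p.@[fun i => nu u (enum_val i)] = q.[u].
  rewrite mevalE horner_sum; apply: eq_bigr => m _.
  rewrite hornerZ horner_prod; congr (_ * _).
  by apply: eq_bigr => i _; rewrite horner_exp nuE.
rewrite pE (@poly_infinite_roots _ q s) ?horner0 // => u /S_nu; rewrite -pE.
exact.
Qed.

(** * Degenerations *)

(** The terms of weight w_i + w_j - w_k at most 0; when the product has no term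
of negative weight, this is its component of weight 0. *)
Definition initial_part (K : fieldType) (w : 'I_3 -> nat) (mu : product3 K) :
    product3 K :=
  [ffun t : idx3 => if (w t.1.1 + w t.1.2 <= w t.2)%N then mu t else 0].

(** In the basis t^(w_i) e_i the structure constants of mu are multiplied by
t^(w_i + w_j - w_k). The hypothesis makes these exponents nonnegative, so the
family extends to t = 0, where it takes the value initial_part w mu. *)
Lemma initial_part_closure (K : numFieldType) (w : 'I_3 -> nat)
    (mu : product3 K) :
  (forall i j k, mu (i, j, k) != 0 -> (w k <= w i + w j)%N) ->
  zariski_closure (orbit3 mu) (initial_part w mu).
Proof.
move=> w_mu; pose d (u : idx3) := (w u.1.1 + w u.1.2 - w u.2)%N.
pose nu (t : K) : product3 K := [ffun u => mu u * t ^+ d u].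
have -> : initial_part w mu = nu 0.
  apply/ffunP=> -[[i j] k]; rewrite !ffunE expr0n /= subn_eq0.
  by case: ifP; rewrite ?mulr1 ?mulr0.
apply: (@closure_curve _ _ nu (fun u => (mu u)%:P * 'X^(d u)) [:: 0]) => [t u|t].
  by rewrite ffunE !hornerE.
(* Away from t = 0, the diagonal matrix of the t^(w_i) is an isomorphism. *)
rewrite inE => t_neq0; apply: closure_sub; apply/orbit3P/isomorphic_sym.
pose D : 'rV[K]_3 := \row_i t ^+ w i.
exists (diag_mx D).
  rewrite unitmxE det_diag unitfE; apply/prodf_neq0 => i _.
  by rewrite mxE expf_neq0.
move=> x y; apply/colP=> k; rewrite mul_diag_mx !mxE mulr_sumr.
apply: eq_bigr => i _; rewrite mulr_sumr; apply: eq_bigr => j _.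
rewrite !mul_diag_mx !mxE ffunE /d /=.
have [->|/w_mu le_w] := eqVneq (mu (i, j, k)) 0; first by rewrite !(mulr0, mul0r).
have -> : t ^+ w i * x i 0 * (t ^+ w j * y j 0) * mu (i, j, k)
  = x i 0 * y j 0 * mu (i, j, k) * (t ^+ w i * t ^+ w j) by ring.
by rewrite -exprD -(subnK le_w) exprD subnK //; ring.
Qed.

Lemma frame_mulmx (K : fieldType) (g : 'M[K]_3) (u v w : 'cV[K]_3) :
  frame (g *m u) (g *m v) (g *m w) = g *m frame u v w.
Proof.
apply/matrixP=> k i; rewrite !mxE.
by case: (ord3P i) => -> /=; rewrite mxE; apply: eq_bigr => j _; rewrite mxE.
Qed.

Lemma frame_basis (K : fieldType) (u v w : 'cV[K]_3) (i : 'I_3) :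
  frame u v w *m basis3 K i = nth 0 [:: u; v; w] i.
Proof. by apply/colP=> k; rewrite mulmx_basis mxE. Qed.

Lemma det_frame_col3 (K : fieldType) (a1 a2 a3 b1 b2 b3 c1 c2 c3 : K) :
  \det (frame (col3 a1 a2 a3) (col3 b1 b2 b3) (col3 c1 c2 c3)) =
  a1 * (b2 * c3 - c2 * b3) - b1 * (a2 * c3 - c2 * a3) + c1 * (a2 * b3 - b2 * a3).
Proof. by rewrite det3 !mxE. Qed.

(** Cramer's rule: it lets the third coordinate of a vector in a frame be
specified by a determinant, hence checked by a polynomial identity. *)
Lemma cramer3 (K : fieldType) (u v w x : 'cV[K]_3) :
  \det (frame u v (frame u v w *m x)) = x i3 0 * \det (frame u v w).
Proof.
rewrite [frame u v (_ *m _)](_ : _ = frame u v w *m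
    frame (basis3 K i1) (basis3 K i2) x); last first.
  by rewrite -frame_mulmx !frame_basis.
rewrite det_mulmx mulrC; congr (_ * _).
by rewrite det3 !mxE /=; ring.
Qed.

Lemma structure_in_frame (K : fieldType) (mu : product3 K) (u v w : 'cV[K]_3) :
  \det (frame u v w) != 0 ->
  exists2 nu, orbit3 mu nu & forall i j,
    frame u v w *m mul nu (basis3 K i) (basis3 K j)
      = mul mu (nth 0 [:: u; v; w] i) (nth 0 [:: u; v; w] j).
Proof.
move=> det_neq0; have F_unit : frame u v w \in unitmx by rewrite unitmxE unitfE.
exists (GL_act (invmx (frame u v w)) mu).
  by exists (invmx (frame u v w)); rewrite ?unitmx_inv.
by move=> i j; rewrite mul_GL_act mulKVmx // invmxK !frame_basis.
Qed.

Definition form_product (K : fieldType) (p11 p12 p21 p22 : K) : product3 K :=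
  [ffun t : idx3 =>
    if (t.1.1 < 2)%N && (t.1.2 < 2)%N && (t.2 == i3)
    then nth 0 (nth [::] [:: [:: p11; p12]; [:: p21; p22]] t.1.1) t.1.2 else 0].

(** With weights (1, 1, 2), only the e_3-coordinates of the products of the
first two basis vectors have weight 0, and no exponent is negative: every frame
gives a degeneration. Here f w != 0 says that u, v, w is a frame, and the four
equations say that p is the form that the product induces on the plane of u and
v, with values in the quotient line. *)
Lemma form_closure (K : numFieldType) (mu : product3 K) (u v w : 'cV[K]_3)
    (p11 p12 p21 p22 : K) :
  let f x := \det (frame u v x) in
  f w != 0 ->
  f (mul mu u u) = p11 * f w -> f (mul mu u v) = p12 * f w ->
  f (mul mu v u) = p21 * f w -> f (mul mu v v) = p22 * f w ->
  zariski_closure (orbit3 mu) (form_product p11 p12 p21 p22).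
Proof.
move=> f fw_neq0 f11 f12 f21 f22.
have [nu mu_nu nuE] := @structure_in_frame _ mu _ _ _ fw_neq0.
apply: closure_orbit_trans (closure_sub mu_nu) _.
have nu3 (i j : 'I_3) c :
    f (mul mu (nth 0 [:: u; v; w] i) (nth 0 [:: u; v; w] j)) = c * f w ->
    nu (i, j, i3) = c.
  by rewrite -nuE /f cramer3 mul_basis => /(mulIf fw_neq0).
have nuE3 := (nu3 i1 i1 _ f11, nu3 i1 i2 _ f12, nu3 i2 i1 _ f21, nu3 i2 i2 _ f22).
pose wt (i : 'I_3) := nth 0%N [:: 1; 1; 2]%N i.
rewrite [form_product _ _ _ _](_ : _ = initial_part wt nu).
  apply: initial_part_closure => i j k _; rewrite /wt.
  by case: (ord3P i) => ->; case: (ord3P j) => ->; case: (ord3P k) => ->.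
apply/ffunP=> -[[i j] k]; rewrite !ffunE /wt.
by case: (ord3P i) => ->; case: (ord3P j) => ->; case: (ord3P k) => -> //=;
  rewrite nuE3.
Qed.

Lemma structB_B5 (K : fieldType) (b : K) :
  structB (B5 b) = form_product 0 b (b - 1) 0.
Proof.
apply/ffunP=> -[[i j] k]; rewrite !ffunE /=.
by case: (ord3P i) => ->; case: (ord3P j) => ->; case: (ord3P k) => -> /=;
  rewrite !mxE /= ?mulr1 ?mulr0.
Qed.

Lemma structB_B3 (K : fieldType) :
  structB (B3 : typeB K) = form_product 0 (1 / 2) (- (1 / 2)) 1.
Proof.
apply/ffunP=> -[[i j] k]; rewrite !ffunE /=.
by case: (ord3P i) => ->; case: (ord3P j) => ->; case: (ord3P k) => -> /=;
  rewrite !mxE /= ?mulr1 ?mulr0.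
Qed.

(** In the frame x^2, x, z with weights (2, 1, 3), the only exponent that could
be negative belongs to the z-coordinate of x x, which is 0. The terms of weight
0 are x x = x^2 and the z-coordinates of x^2 x and x x^2. *)
Lemma B4_closure (K : numFieldType) (mu : product3 K) (x z : 'cV[K]_3) (a : K) :
  let f y := \det (frame (mul mu x x) x y) in
  f z != 0 -> f (mul mu (mul mu x x) x) = a * f z ->
  f (mul mu x (mul mu x x)) = (a - 1) * f z ->
  zariski_closure (orbit3 mu) (structB (B4 a)).
Proof.
move=> f fz_neq0 f12 f21.
have [nu mu_nu nuE] := @structure_in_frame _ mu _ _ _ fz_neq0.
apply: closure_orbit_trans (closure_sub mu_nu) _.
have nu12 : nu (i1, i2, i3) = a.
  apply: (mulIf fz_neq0); rewrite -[RHS]f12 /f -mul_basis -cramer3.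
  by rewrite (nuE i1 i2).
have nu21 : nu (i2, i1, i3) = a - 1.
  apply: (mulIf fz_neq0); rewrite -[RHS]f21 /f -mul_basis -cramer3.
  by rewrite (nuE i2 i1).
have nu22 k : nu (i2, i2, k) = (k == i1)%:R.
  have F_unit : frame (mul mu x x) x z \in unitmx by rewrite unitmxE unitfE.
  have e22 : mul nu (basis3 K i2) (basis3 K i2) = basis3 K i1.
    by apply: (can_inj (mulKmx F_unit)); rewrite nuE frame_basis.
  by rewrite -mul_basis e22 mxE andbT.
pose wt (i : 'I_3) := nth 0%N [:: 2; 1; 3]%N i.
rewrite [structB _](_ : _ = initial_part wt nu).
  apply: initial_part_closure => i j k; rewrite /wt.
  by case: (ord3P i) => ->; case: (ord3P j) => ->; case: (ord3P k) => -> //=;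
    rewrite nu22 eqxx.
apply/ffunP=> -[[i j] k]; rewrite !ffunE /wt.
by case: (ord3P i) => ->; case: (ord3P j) => ->; case: (ord3P k) => -> //=;
  rewrite !mxE /= ?(nu12, nu21, nu22) ?mulr1 ?mulr0.
Qed.

Lemma mul_structC (K : fieldType) (A : typeC K) (a b c x y z : K) :
  mul (structC A) (col3 a b c) (col3 x y z) =
  match A with
  | C1 => col3 (- (a * x)) (a * x - b * x) (c * z)
  | C2 => col3 (- (a * x)) (a * x - b * x) (- (a * z) - c * x)
  | C3 => col3 (- (a * x)) (a * x - b * x) 0
  | C4 => col3 0 (a * y) (a * x)
  | C5 t => col3 (t * a * x) ((t + 1) * a * y + t * b * x) 0
  | C6 t => col3 (t * a * x) ((t + 1) * a * y + t * b * x) (c * z)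
  | C7 t _ => col3 (t * a * x) ((t + 1) * a * y + t * b * x) (t * (a * z + c * x))
  end.
Proof.
apply/colP=> k; rewrite mul_coord.
by case: A => [||||t|t|t ?]; case: (ord3P k) => ->;
  rewrite !ffunE !mxE /= ?mxE /=; ring.
Qed.

Lemma mul_structB (K : fieldType) (B : typeB K) (a b c x y z : K) :
  mul (structB B) (col3 a b c) (col3 x y z) =
  match B with
  | B1 => col3 (a * x) (a * y + b * x) (a * y + a * z + c * x)
  | B2 => col3 (a * x) (a * y + b * x) (a * y + a * z + b * y + c * x)
  | B3 => col3 0 0 (1 / 2 * (a * y - b * x) + b * y)
  | B4 t => col3 (b * y) 0 (t * a * y + (t - 1) * b * x)
  | B5 t => col3 0 0 (t * a * y + (t - 1) * b * x)
  end.
Proof.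
apply/colP=> k; rewrite mul_coord.
by case: B => [|||t|t]; case: (ord3P k) => ->;
  rewrite !ffunE !mxE /= ?mxE /=; ring.
Qed.

(** * Closed conditions that do not depend on the basis *)

(** A linear form on the algebra, invariant under isomorphism, that normalizes
the eigenvalues of right multiplication. *)
Definition trace_gap (K : fieldType) (mu : product3 K) (y : 'cV[K]_3) : K :=
  \tr (Lmx mu y) - \tr (Rmx mu y).

Definition eigenvalue_condition (K : fieldType) (c : K)
    (mu : product3 K) : Prop :=
  forall y, \det (Rmx mu y - (c * trace_gap mu y)%:M) = 0.

(** A nonzero xi represents the projection onto the line A/P, where P is its
kernel; f of a product is then the form that the product induces on P. *)
Definition discriminant_condition (K : fieldType) (d : K)
    (mu : product3 K) : Prop :=
  forall (xi : 'rV[K]_3) x y, xi *m x = 0 -> xi *m y = 0 ->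
  let f u := (xi *m u) 0 0 in
  f (mul mu x x) * f (mul mu y y) - f (mul mu x y) * f (mul mu y x)
    = d * (f (mul mu x y) - f (mul mu y x)) ^+ 2.

Definition cubic_condition (K : fieldType) (s t : K) (mu : product3 K) : Prop :=
  forall x, \det (frame x (mul mu x x)
    (s *: mul mu (mul mu x x) x + t *: mul mu x (mul mu x x))) = 0.

Lemma Rmx_iso (K : fieldType) (g : 'M[K]_3) (mu nu : product3 K) y :
  g \in unitmx -> (forall x y, g *m mul mu x y = mul nu (g *m x) (g *m y)) ->
  Rmx nu y = g *m Rmx mu (invmx g *m y) *m invmx g.
Proof.
move=> g_unit gP; apply/matrixP=> k i; rewrite mxE (mul_iso _ _ g_unit gP).
by rewrite -Rmx_mul !mulmxA mulmx_basis.
Qed.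

Lemma Lmx_iso (K : fieldType) (g : 'M[K]_3) (mu nu : product3 K) x :
  g \in unitmx -> (forall x y, g *m mul mu x y = mul nu (g *m x) (g *m y)) ->
  Lmx nu x = g *m Lmx mu (invmx g *m x) *m invmx g.
Proof.
move=> g_unit gP; apply/matrixP=> k i; rewrite mxE (mul_iso _ _ g_unit gP).
by rewrite -Lmx_mul !mulmxA mulmx_basis.
Qed.

Lemma trace_gap_iso (K : fieldType) (g : 'M[K]_3) (mu nu : product3 K) y :
  g \in unitmx -> (forall x y, g *m mul mu x y = mul nu (g *m x) (g *m y)) ->
  trace_gap nu y = trace_gap mu (invmx g *m y).
Proof.
move=> g_unit gP; rewrite /trace_gap (Rmx_iso _ g_unit gP) (Lmx_iso _ g_unit gP).
have tr_conj M : \tr (g *m M *m invmx g) = \tr M by rewrite mxtrace_mulC mulKmx.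
by rewrite !tr_conj.
Qed.

Lemma eigenvalue_condition_iso (K : fieldType) (c : K) (mu nu : product3 K) :
  isomorphic mu nu -> eigenvalue_condition c mu -> eigenvalue_condition c nu.
Proof.
move=> [g g_unit gP] mu_c y; rewrite (Rmx_iso _ g_unit gP) (trace_gap_iso _ g_unit gP).
rewrite -[X in _ - X](mulmxK g_unit) -scalar_mxC -mulmxBl -mulmxBr.
by rewrite !det_mulmx mu_c mulr0 mul0r.
Qed.

Lemma discriminant_condition_iso (K : fieldType) (d : K) (mu nu : product3 K) :
  isomorphic mu nu -> discriminant_condition d mu -> discriminant_condition d nu.
Proof.
move=> [g g_unit gP] mu_d xi x y xi_x xi_y /=.
rewrite !(mul_iso _ _ g_unit gP) !(mulmxA xi).
by apply: (mu_d (xi *m g)); rewrite -mulmxA mulKVmx.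
Qed.

Lemma cubic_condition_iso (K : fieldType) (s t : K) (mu nu : product3 K) :
  isomorphic mu nu -> cubic_condition s t mu -> cubic_condition s t nu.
Proof.
move=> [g g_unit gP] mu_st x; rewrite -(mulKVmx g_unit x); set z := _ *m x.
by rewrite -!gP !scalemxAr -mulmxDr frame_mulmx det_mulmx mu_st mulr0.
Qed.

Lemma zariski_closed_eigenvalue (K : fieldType) c (S : product3 K -> Prop) nu :
  zariski_closure S nu -> (forall mu, S mu -> eigenvalue_condition c mu) ->
  eigenvalue_condition c nu.
Proof.
move=> S_nu S_c y.
apply: (closure_polynomial_zero
  (f := fun mu => \det (Rmx mu y - (c * trace_gap mu y)%:M)) S_nu) => [|mu /S_c //].
have polR i j : polynomial_function (fun mu => Rmx mu y i j).
  by apply: pf_ext (pv_mul (pv_const (basis3 K j)) (pv_const y) i) _ => mu;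
    rewrite [RHS]mxE.
have polL i j : polynomial_function (fun mu => Lmx mu y i j).
  by apply: pf_ext (pv_mul (pv_const y) (pv_const (basis3 K j)) i) _ => mu;
    rewrite [RHS]mxE.
apply: pf_det => i j.
apply: (@pf_ext _ (fun mu => Rmx mu y i j - c * trace_gap mu y * (i == j)%:R)).
  apply: pf_add => //; apply/pf_opp/pf_mul; last exact: pf_const.
  apply: pf_mul; first exact: pf_const.
  by apply: pf_add; last apply: pf_opp; apply: pf_sum => k.
by move=> mu; rewrite !mxE mulr_natr.
Qed.

Lemma zariski_closed_discriminant (K : fieldType) d (S : product3 K -> Prop) nu :
  zariski_closure S nu -> (forall mu, S mu -> discriminant_condition d mu) ->
  discriminant_condition d nu.
Proof.
move=> S_nu S_d xi x y xi_x xi_y f; apply/eqP; rewrite -subr_eq0; apply/eqP.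
have polf u v : polynomial_function (fun mu => f (mul mu u v)).
  by apply: pv_mulmx; apply: pv_mul; apply: pv_const.
apply: (closure_polynomial_zero (f := fun mu =>
  f (mul mu x x) * f (mul mu y y) - f (mul mu x y) * f (mul mu y x)
  - d * (f (mul mu x y) - f (mul mu y x)) ^+ 2) S_nu) => [|mu /S_d mu_d].
  apply: pf_add; first by apply: pf_add; [|apply: pf_opp]; apply: pf_mul.
  apply/pf_opp/pf_mul; first exact: pf_const.
  by apply: pf_mul; apply: pf_add => //; apply: pf_opp.
by apply/eqP; rewrite subr_eq0; apply/eqP/mu_d.
Qed.

Lemma zariski_closed_cubic (K : fieldType) s t (S : product3 K -> Prop) nu :
  zariski_closure S nu -> (forall mu, S mu -> cubic_condition s t mu) ->
  cubic_condition s t nu.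
Proof.
move=> S_nu S_st x.
apply: (closure_polynomial_zero (f := fun mu => \det (frame x (mul mu x x)
  (s *: mul mu (mul mu x x) x + t *: mul mu x (mul mu x x)))) S_nu)
  => [|mu /S_st //].
have polx2 := pv_mul (pv_const x) (pv_const x).
have polx3 := pv_add (pv_scale s (pv_mul polx2 (pv_const x)))
                     (pv_scale t (pv_mul (pv_const x) polx2)).
apply: pf_det => k i; case: (ord3P i) => ->.
- by apply: pf_ext (pv_const x k) _ => mu; rewrite !mxE.
- by apply: pf_ext (polx2 k) _ => mu; rewrite [RHS]mxE.
- by apply: pf_ext (polx3 k) _ => mu; rewrite [RHS]mxE.
Qed.

Lemma trace_gapE (K : fieldType) (mu : product3 K) y :
  trace_gap mu y = \sum_i \sum_j y i 0 * (mu (i, j, j) - mu (j, i, j)).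
Proof.
rewrite /trace_gap /mxtrace exchange_big /= -sumrB; apply: eq_bigr => j _.
rewrite [Lmx _ _ _ _]mxE [Rmx _ _ _ _]mxE mul_basisl mul_basisr -sumrB.
by apply: eq_bigr => i _; rewrite mulrBr.
Qed.

Lemma trace_gap_structC (K : fieldType) (A : typeC K) y :
  trace_gap (structC A) y = y i1 0.
Proof.
rewrite trace_gapE !big_ord3.
by case: A => [||||t|t|t ?]; rewrite !ffunE !mxE /=; ring.
Qed.

Lemma trace_gap_structB (K : fieldType) (B : typeB K) y :
  trace_gap (structB B) y = 0.
Proof.
rewrite trace_gapE !big_ord3.
by case: B => [|||t|t]; rewrite !ffunE !mxE /=; ring.
Qed.

(** * Verification on the two lists *)

Lemma col3_add (K : fieldType) (a b c x y z : K) :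
  col3 a b c + col3 x y z = col3 (a + x) (b + y) (c + z).
Proof. by apply/colP=> k; rewrite !mxE; case: (ord3P k) => ->. Qed.

Lemma col3_scale (K : fieldType) (t a b c : K) :
  t *: col3 a b c = col3 (t * a) (t * b) (t * c).
Proof. by apply/colP=> k; rewrite !mxE; case: (ord3P k) => ->. Qed.

Lemma basis3_col3 (K : fieldType) :
  (basis3 K i1 = col3 1 0 0) * (basis3 K i2 = col3 0 1 0)
  * (basis3 K i3 = col3 0 0 1).
Proof. by do 2?split; apply/colP=> k; rewrite !mxE; case: (ord3P k) => ->. Qed.

Lemma row_col3 (K : fieldType) (xi : 'rV[K]_3) (a b c : K) :
  (xi *m col3 a b c) 0 0 = xi 0 i1 * a + xi 0 i2 * b + xi 0 i3 * c.
Proof. by rewrite mxE big_ord3 !mxE. Qed.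

(** The eigenvalue of right multiplication by e_1 for which e_1 is a generalized
eigenvector; here tau(e_1) = 1. *)
Definition eigen_ratio (K : fieldType) (A : typeC K) : K :=
  match A with
  | C1 | C2 | C3 => -1
  | C4 => 0
  | C5 a => a
  | C6 b => b
  | C7 c _ => c
  end.

Lemma structC_eigenvalue (K : fieldType) (A : typeC K) :
  eigenvalue_condition (eigen_ratio A) (structC A).
Proof.
move=> y; rewrite trace_gap_structC (col3_eta y).
set u := y i1 0; set v := y i2 0; set w := y i3 0.
have entry i j : (Rmx (structC A) (col3 u v w) - (eigen_ratio A * u)%:M) i j
    = mul (structC A) (basis3 K j) (col3 u v w) i 0
      - (eigen_ratio A * u) *+ (i == j).
  rewrite (_ : mul _ _ _ i 0 = Rmx (structC A) (col3 u v w) i j).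
    by move: (Rmx _ _) => R; rewrite !mxE.
  by rewrite [RHS]mxE.
rewrite [col3 u v w i1 0]mxE /= det3 !entry !basis3_col3 !mul_structC.
by case: A {entry} => [||||a|b|c ?] /=; rewrite !mxE /=; ring.
Qed.

(** Right multiplication is, up to a scalar depending on the right factor, of
the form p x * q y after composition with xi. On the kernel of xi the scalar
term disappears, so the induced form is a product of two linear forms and its
determinant vanishes. *)
Lemma split_discriminant (K : fieldType) (mu : product3 K) :
  (forall xi : 'rV[K]_3, exists s p q : 'cV[K]_3 -> K, forall x y,
     (xi *m mul mu x y) 0 0 = s y * (xi *m x) 0 0 + p x * q y) ->
  discriminant_condition 0 mu.
Proof.
move=> split_mu xi x y xi_x xi_y f; have [s [p [q fE]]] := split_mu xi.
by rewrite /f !fE xi_x xi_y mxE; ring.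
Qed.

Lemma C2_discriminant (K : fieldType) :
  discriminant_condition 0 (structC (@C2 K)).
Proof.
apply: split_discriminant => xi.
exists (fun y => - y i1 0), (fun x => x i1 0),
  (fun y => xi 0 i2 * y i1 0 - xi 0 i3 * y i3 0).
move=> x y; rewrite (col3_eta x) (col3_eta y) mul_structC !row_col3 !mxE /=.
ring.
Qed.

Lemma C3_discriminant (K : fieldType) :
  discriminant_condition 0 (structC (@C3 K)).
Proof.
apply: split_discriminant => xi.
exists (fun y => - y i1 0), (fun x => xi 0 i2 * x i1 0 + xi 0 i3 * x i3 0),
  (fun y => y i1 0).
move=> x y; rewrite (col3_eta x) (col3_eta y) mul_structC !row_col3 !mxE /=.
ring.
Qed.

Lemma C4_discriminant (K : fieldType) :
  discriminant_condition 0 (structC (@C4 K)).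
Proof.
apply: split_discriminant => xi.
exists (fun=> 0), (fun x => x i1 0),
  (fun y => xi 0 i2 * y i2 0 + xi 0 i3 * y i1 0).
move=> x y; rewrite (col3_eta x) (col3_eta y) mul_structC !row_col3 !mxE /=.
ring.
Qed.

Lemma C5_discriminant (K : fieldType) (a : K) :
  discriminant_condition (- (a * (a + 1))) (structC (C5 a)).
Proof.
move=> xi x y _ _ f; rewrite /f (col3_eta x) (col3_eta y) !mul_structC !row_col3.
ring.
Qed.

Lemma C6_N1_discriminant (K : fieldType) :
  discriminant_condition 0 (structC (C6 (-1 : K))).
Proof.
apply: split_discriminant => xi.
exists (fun y => - y i1 0), (fun x => xi 0 i3 * x i3 0),
  (fun y => y i1 0 + y i3 0).
move=> x y; rewrite (col3_eta x) (col3_eta y) mul_structC !row_col3 !mxE /=.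
ring.
Qed.

Lemma C7_discriminant (K : fieldType) (c : K) (c_neq0 : c != 0) :
  discriminant_condition 0 (structC (C7 c_neq0)).
Proof.
apply: split_discriminant => xi.
exists (fun y => c * y i1 0), (fun x => x i1 0),
  (fun y => xi 0 i2 * ((c + 1) * y i2 0) + xi 0 i3 * (c * y i3 0)).
move=> x y; rewrite (col3_eta x) (col3_eta y) mul_structC !row_col3 !mxE /=.
ring.
Qed.

Ltac cubic_by_coordinates :=
  let x := fresh "x" in
  move=> x; rewrite (col3_eta x) !mul_structC !col3_scale !col3_add
                    det_frame_col3; ring.

Lemma C2_cubic (K : fieldType) : cubic_condition 1 0 (structC (@C2 K)).
Proof. cubic_by_coordinates. Qed.

Lemma C3_cubic (K : fieldType) : cubic_condition 0 1 (structC (@C3 K)).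
Proof. cubic_by_coordinates. Qed.

Lemma C4_cubic (K : fieldType) : cubic_condition 1 0 (structC (@C4 K)).
Proof. cubic_by_coordinates. Qed.

Lemma C5_cubic (K : fieldType) (a : K) :
  cubic_condition (a + 1) (- a) (structC (C5 a)).
Proof. cubic_by_coordinates. Qed.

Lemma C5_0_cubic (K : fieldType) (s t : K) :
  cubic_condition s t (structC (C5 (0 : K))).
Proof. cubic_by_coordinates. Qed.

Lemma C5_N1_cubic (K : fieldType) (s t : K) :
  cubic_condition s t (structC (C5 (-1 : K))).
Proof. cubic_by_coordinates. Qed.

Lemma C6_N1_cubic (K : fieldType) (s t : K) :
  cubic_condition s t (structC (C6 (-1 : K))).
Proof. cubic_by_coordinates. Qed.

Lemma C7_cubic (K : fieldType) (c : K) (c_neq0 : c != 0) :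
  cubic_condition 1 0 (structC (C7 c_neq0)).
Proof. cubic_by_coordinates. Qed.

Lemma C7_N1_cubic (K : fieldType) (s t : K) (N1_neq0 : (-1 : K) != 0) :
  cubic_condition s t (structC (C7 N1_neq0)).
Proof. cubic_by_coordinates. Qed.

(** Right multiplication by e is the identity, whose only eigenvalue is 1. *)
Lemma right_unit_eigenvalue (K : fieldType) (c : K) (mu : product3 K) e :
  (forall x, mul mu x e = x) -> trace_gap mu e = 0 -> ~ eigenvalue_condition c mu.
Proof.
move=> e_unit tau0 /(_ e); rewrite tau0 mulr0 raddf0 subr0.
have -> : Rmx mu e = 1%:M.
  by apply/matrixP=> k i; rewrite mxE e_unit !mxE andbT.
by rewrite det1 => /eqP; rewrite oner_eq0.
Qed.

Lemma B1_eigenvalue (K : fieldType) (c : K) :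
  ~ eigenvalue_condition c (structB B1).
Proof.
apply: (right_unit_eigenvalue (e := col3 1 0 0)); last exact: trace_gap_structB.
by move=> x; rewrite {1}(col3_eta x) mul_structB [RHS]col3_eta; congr col3; ring.
Qed.

Lemma B2_eigenvalue (K : fieldType) (c : K) :
  ~ eigenvalue_condition c (structB B2).
Proof.
apply: (right_unit_eigenvalue (e := col3 1 0 0)); last exact: trace_gap_structB.
by move=> x; rewrite {1}(col3_eta x) mul_structB [RHS]col3_eta; congr col3; ring.
Qed.

(** The instance for the plane of e_1 and e_2; in B3, B4(a) and B5(b) the form
on this plane is not symmetric, so that it determines d. *)
Lemma discriminant_at_basis (K : fieldType) (d : K) (mu : product3 K) :
  discriminant_condition d mu ->
  mu (i1, i1, i3) * mu (i2, i2, i3) - mu (i1, i2, i3) * mu (i2, i1, i3)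
    = d * (mu (i1, i2, i3) - mu (i2, i1, i3)) ^+ 2.
Proof.
pose xi : 'rV[K]_3 := delta_mx 0 i3.
have xiE (u : 'cV[K]_3) : xi *m u = (u i3 0)%:M.
  by apply/matrixP=> i j; rewrite -rowE !ord1 !mxE.
move=> /(_ xi (basis3 K i1) (basis3 K i2)).
have xi0 i : i != i3 -> xi *m basis3 K i = 0.
  by move=> ne_i3; rewrite xiE mxE eq_sym (negPf ne_i3) raddf0.
have fE i j : (xi *m mul mu (basis3 K i) (basis3 K j)) 0 0 = mu (i, j, i3).
  by rewrite xiE mxE eqxx mul_basis.
by move=> /(_ (xi0 i1 isT) (xi0 i2 isT)) /=; rewrite !fE.
Qed.

Lemma discriminant_B3 (K : numFieldType) (d : K) :
  discriminant_condition d (structB B3) -> d = 1 / 4.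
Proof.
move/discriminant_at_basis; rewrite !ffunE !mxE /= => dE.
by transitivity (d * (1 / 2 * 1 - - (1 / 2) * 1) ^+ 2); [field | rewrite -dE; field].
Qed.

Lemma discriminant_B4 (K : fieldType) (a d : K) :
  discriminant_condition d (structB (B4 a)) -> d = a * (1 - a).
Proof.
move/discriminant_at_basis; rewrite !ffunE !mxE /= => dE.
by transitivity (d * (a * 1 - (a - 1) * 1) ^+ 2); [ring | rewrite -dE; ring].
Qed.

Lemma discriminant_B5 (K : fieldType) (b d : K) :
  discriminant_condition d (structB (B5 b)) -> d = b * (1 - b).
Proof.
move/discriminant_at_basis; rewrite !ffunE !mxE /= => dE.
by transitivity (d * (b * 1 - (b - 1) * 1) ^+ 2); [ring | rewrite -dE; ring].
Qed.

(** For x = e_2 the vectors x, x^2, x^2 x, x x^2 are e_2, e_1, a e_3 and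
(a - 1) e_3. *)
Lemma cubic_B4 (K : fieldType) (s t a : K) :
  cubic_condition s t (structB (B4 a)) -> s * a + t * (a - 1) = 0.
Proof.
move=> /(_ (col3 0 1 0)); rewrite !mul_structB !col3_scale !col3_add det_frame_col3.
by move=> e; rewrite -[LHS]opprK; apply/eqP; rewrite oppr_eq0 -e; apply/eqP; ring.
Qed.

(** Exchanging e_1 and e_2 turns b and b - 1 around; the change of sign of e_3
restores the difference 1. *)
Lemma B5_iso (K : fieldType) (b : K) :
  isomorphic (structB (B5 b)) (structB (B5 (1 - b))).
Proof.
pose g : 'M[K]_3 := frame (col3 0 1 0) (col3 1 0 0) (col3 0 0 (-1)).
have gE (x y z : K) : g *m col3 x y z = col3 y x (- z).
  apply/colP=> k; rewrite mxE big_ord3 !mxE.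
  by case: (ord3P k) => -> /=; rewrite ?mxE /=; ring.
exists g => [|x y].
  rewrite unitmxE det_frame_col3 unitfE.
  by rewrite (_ : _ + _ = 1) ?oner_neq0 //; ring.
rewrite (col3_eta x) (col3_eta y) mul_structB !gE mul_structB.
by congr col3; ring.
Qed.

(** * The degenerations of the list *)

(** The form induced on the plane of e_1 and e_2 loses the product
e_2 e_2 = e_1, which lies in that plane. *)
Lemma B4_to_B5 (K : numFieldType) (mu : product3 K) (a : K) :
  zariski_closure (orbit3 mu) (structB (B4 a)) ->
  zariski_closure (orbit3 mu) (structB (B5 a)).
Proof.
move=> mu_B4; apply: closure_orbit_trans mu_B4 _; rewrite structB_B5.
apply: (form_closure (u := col3 1 0 0) (v := col3 0 1 0) (w := col3 0 0 1));
  rewrite ?mul_structB !det_frame_col3; [|ring..].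
by rewrite (_ : _ + _ = 1) ?oner_neq0 //; ring.
Qed.

(** On the plane of e_1 - e_3 and e_2 the product e_2 e_2 = e_1 is congruent to
e_3, which gives the form of B3. *)
Lemma B4_to_B3 (K : numFieldType) (mu : product3 K) :
  zariski_closure (orbit3 mu) (structB (B4 (1 / 2))) ->
  zariski_closure (orbit3 mu) (structB B3).
Proof.
move=> mu_B4; apply: closure_orbit_trans mu_B4 _; rewrite structB_B3.
apply: (form_closure (u := col3 1 0 (-1)) (v := col3 0 1 0) (w := col3 0 0 1));
  rewrite ?mul_structB !det_frame_col3; [|by field..].
by rewrite (_ : _ + _ = 1) ?oner_neq0 //; ring.
Qed.

(** The structure constants of B4(a) are affine in a, so the excluded parameters
are reached along a line. *)
Lemma generic_B4_closure (K : numFieldType) (mu : product3 K) (s : seq K) :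
  (forall a, a \notin s -> zariski_closure (orbit3 mu) (structB (B4 a))) ->
  forall a, zariski_closure (orbit3 mu) (structB (B4 a)).
Proof.
move=> mu_B4 a; pose B i : K := structB (B4 (0 : K)) i.
pose c i := (B i)%:P + (structB (B4 1) i - B i) *: 'X.
apply: (@closure_curve _ _ (fun t => structB (B4 t)) c s) => // t [[i j] k].
rewrite !hornerE /B !ffunE.
by case: (ord3P i) => ->; case: (ord3P j) => -> /=; rewrite !mxE /=; ring.
Qed.

(** The third coordinate of x controls the limit algebra. The vector z is the
commutator [x^2, x], here and in the next six lemmas. *)
Lemma C1_B4_closure (K : numFieldType) (a : K) :
  zariski_closure (orbit3 (structC C1)) (structB (B4 a)).
Proof.
apply: (@generic_B4_closure _ _ [:: 0; 1]) => {}a.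
rewrite !inE negb_or => /andP[a_neq0 a_neq1].
apply: (B4_closure (x := col3 1 0 (a - 1)) (z := col3 0 (-1) 0));
  rewrite ?mul_structC !det_frame_col3; [|ring..].
rewrite (_ : _ + _ = (1 - a) * a); last by ring.
by rewrite mulf_neq0 // subr_eq0 eq_sym.
Qed.

Lemma C2_B4_closure (K : numFieldType) :
  zariski_closure (orbit3 (structC C2)) (structB (B4 (0 : K))).
Proof.
apply: (B4_closure (x := col3 1 0 1) (z := col3 0 (-1) 0));
  rewrite ?mul_structC !det_frame_col3; [|ring..].
by rewrite (_ : _ + _ = 1) ?oner_neq0 //; ring.
Qed.

Lemma C3_B4_closure (K : numFieldType) :
  zariski_closure (orbit3 (structC C3)) (structB (B4 (1 : K))).
Proof.
apply: (B4_closure (x := col3 1 0 1) (z := col3 0 (-1) 0));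
  rewrite ?mul_structC !det_frame_col3; [|ring..].
by rewrite (_ : _ + _ = -1) ?oppr_eq0 ?oner_neq0 //; ring.
Qed.

Lemma C4_B4_closure (K : numFieldType) :
  zariski_closure (orbit3 (structC C4)) (structB (B4 (0 : K))).
Proof.
apply: (B4_closure (x := col3 1 1 0) (z := col3 0 (-1) 0));
  rewrite ?mul_structC !det_frame_col3; [|ring..].
by rewrite (_ : _ + _ = -1) ?oppr_eq0 ?oner_neq0 //; ring.
Qed.

Lemma C5_B4_closure (K : numFieldType) (a : K) : a != 0 -> a != -1 ->
  zariski_closure (orbit3 (structC (C5 a))) (structB (B4 (- a))).
Proof.
move=> a_neq0 a_neqN1.
apply: (B4_closure (x := col3 1 1 1) (z := col3 0 (- (a + 1)) 0));
  rewrite ?mul_structC !det_frame_col3; [|ring..].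
rewrite (_ : _ + _ = a * (a + 1)); last by ring.
by rewrite mulf_neq0 // addr_eq0.
Qed.

Lemma C6_B4_closure (K : numFieldType) (b a : K) : b != -1 ->
  zariski_closure (orbit3 (structC (C6 b))) (structB (B4 a)).
Proof.
move=> b_neqN1; apply: (@generic_B4_closure _ _ [:: 0; - b]) => {}a.
rewrite !inE negb_or => /andP[a_neq0 a_neqNb].
apply: (B4_closure (x := col3 1 1 (a + b)) (z := col3 0 (- (b + 1)) 0));
  rewrite ?mul_structC !det_frame_col3; [|ring..].
rewrite (_ : _ + _ = - ((b + 1) * (a + b) * a)); last by ring.
by rewrite oppr_eq0 !mulf_neq0 // addr_eq0.
Qed.

Lemma C7_B4_closure (K : numFieldType) (c : K) (c_neq0 : c != 0) : c != -1 ->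
  zariski_closure (orbit3 (structC (C7 c_neq0))) (structB (B4 0)).
Proof.
move=> c_neqN1.
apply: (B4_closure (x := col3 1 1 1) (z := col3 0 (- (c + 1)) 0));
  rewrite ?mul_structC !det_frame_col3; [|ring..].
rewrite (_ : _ + _ = - (c * (c + 1))); last by ring.
by rewrite oppr_eq0 mulf_neq0 // addr_eq0.
Qed.

(** The limit B4(1) yields B5(1), which is isomorphic to B5(0). *)
Lemma C3_B5_closure (K : numFieldType) :
  zariski_closure (orbit3 (structC C3)) (structB (B5 (0 : K))).
Proof.
apply: (closure_iso (B4_to_B5 (@C3_B4_closure K))).
by have := B5_iso (1 : K); rewrite subrr.
Qed.

Lemma C5_0_B5_closure (K : numFieldType) :
  zariski_closure (orbit3 (structC (C5 0))) (structB (B5 (0 : K))).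
Proof.
rewrite structB_B5.
apply: (form_closure (u := col3 0 1 1) (v := col3 1 0 0) (w := col3 0 (-1) 0));
  rewrite ?mul_structC !det_frame_col3; [|ring..].
by rewrite (_ : _ + _ = -1) ?oppr_eq0 ?oner_neq0 //; ring.
Qed.

Lemma C5_N1_B5_closure (K : numFieldType) :
  zariski_closure (orbit3 (structC (C5 (-1)))) (structB (B5 (0 : K))).
Proof.
rewrite structB_B5.
apply: (form_closure (u := col3 1 0 0) (v := col3 0 1 1) (w := col3 0 1 0));
  rewrite ?mul_structC !det_frame_col3; [|ring..].
by rewrite (_ : _ + _ = -1) ?oppr_eq0 ?oner_neq0 //; ring.
Qed.

(** The second vector v is an idempotent, chosen so that v v has no component
outside the plane of e_1 and v. *)
Lemma C6_N1_B5_closure (K : numFieldType) :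
  zariski_closure (orbit3 (structC (C6 (-1)))) (structB (B5 (0 : K))).
Proof.
rewrite structB_B5.
apply: (form_closure (u := col3 1 0 0) (v := col3 (-1) 1 1) (w := col3 0 1 0));
  rewrite ?mul_structC !det_frame_col3; [|ring..].
by rewrite (_ : _ + _ = -1) ?oppr_eq0 ?oner_neq0 //; ring.
Qed.

Lemma C7_N1_B5_closure (K : numFieldType) (N1_neq0 : (-1 : K) != 0) :
  zariski_closure (orbit3 (structC (C7 N1_neq0))) (structB (B5 0)).
Proof.
rewrite structB_B5.
apply: (form_closure (u := col3 0 1 1) (v := col3 1 0 0) (w := col3 0 (-1) 0));
  rewrite ?mul_structC !det_frame_col3; [|ring..].
by rewrite (_ : _ + _ = -1) ?oppr_eq0 ?oner_neq0 //; ring.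
Qed.

Lemma listed_closure (K : numFieldType) (A : typeC K) (B : typeB K) :
  listed A B -> zariski_closure (orbit3 (structC A)) (structB B).
Proof.
have half_neq0 : - (1 / 2 : K) != 0 by rewrite oppr_eq0 mul1r invr_eq0 pnatr_eq0.
have half_neqN1 : - (1 / 2 : K) != -1.
  by rewrite eqr_opp mul1r -[X in _ != X]invr1 (inj_eq invr_inj) (eqr_nat _ 2 1).
have halfE : 1 / 2 = - - (1 / 2) :> K by rewrite opprK.
case; [exact/B4_to_B3/C1_B4_closure|exact: C1_B4_closure
      |move=> a; exact/B4_to_B5/C1_B4_closure
      |exact: C2_B4_closure|exact/B4_to_B5/C2_B4_closure
      |exact: C3_B4_closure|exact: C3_B5_closure
      |exact: C4_B4_closure|exact/B4_to_B5/C4_B4_closure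
      |move=> a a0 _ a1; exact: C5_B4_closure
      |move=> a a0 _ a1; exact/B4_to_B5/C5_B4_closure
      |exact: C5_0_B5_closure|..].
- by apply: B4_to_B3; rewrite {2}halfE; apply: C5_B4_closure.
- by rewrite {2}halfE; apply: C5_B4_closure.
- by apply: B4_to_B5; rewrite {2}halfE; apply: C5_B4_closure.
- exact: C5_N1_B5_closure.
- by move=> b b1; apply/B4_to_B3/C6_B4_closure.
- by move=> b a b1; apply: C6_B4_closure.
- by move=> b a b1; apply/B4_to_B5/C6_B4_closure.
- exact: C6_N1_B5_closure.
- by move=> c c0 c1; apply: C7_B4_closure.
- by move=> c c0 c1; apply/B4_to_B5/C7_B4_closure.
- exact: C7_N1_B5_closure.
Qed.

(** * The obstructions *)

Lemma closure_eigenvalue (K : fieldType) (c : K) (mu nu : product3 K) :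
  eigenvalue_condition c mu -> zariski_closure (orbit3 mu) nu ->
  eigenvalue_condition c nu.
Proof.
move=> mu_c mu_nu; apply: zariski_closed_eigenvalue mu_nu _ => mu'.
by move=> /orbit3P/eigenvalue_condition_iso; apply.
Qed.

Lemma closure_discriminant (K : fieldType) (d : K) (mu nu : product3 K) :
  discriminant_condition d mu -> zariski_closure (orbit3 mu) nu ->
  discriminant_condition d nu.
Proof.
move=> mu_d mu_nu; apply: zariski_closed_discriminant mu_nu _ => mu'.
by move=> /orbit3P/discriminant_condition_iso; apply.
Qed.

Lemma closure_cubic (K : fieldType) (s t : K) (mu nu : product3 K) :
  cubic_condition s t mu -> zariski_closure (orbit3 mu) nu ->
  cubic_condition s t nu.
Proof.
move=> mu_st mu_nu; apply: zariski_closed_cubic mu_nu _ => mu'.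
by move=> /orbit3P/cubic_condition_iso; apply.
Qed.

(** A degenerate induced form leaves, among B3 and the B5(b), only B5(0) up to
isomorphism, and among the B4(a) only the parameters 0 and 1, which the cubic
condition has to separate. *)
Lemma discriminant0_closure (K : numFieldType) (mu : product3 K) (B : typeB K) :
  discriminant_condition 0 mu -> zariski_closure (orbit3 mu) (structB B) ->
  match B with
  | B1 | B2 => True
  | B3 => False
  | B4 a => a = 0 \/ a = 1
  | B5 b => isomorphic (structB B) (structB (B5 0))
  end.
Proof.
move=> mu_0 /(closure_discriminant mu_0).
have root01 (b : K) : 0 = b * (1 - b) -> b = 0 \/ b = 1.
  move/esym/eqP; rewrite mulf_eq0 subr_eq0 => /orP[/eqP->|/eqP<-]; by [left|right].
case: B => [//|//||a|b].
- move=> /discriminant_B3/eqP; rewrite mul1r eq_sym invr_eq0 pnatr_eq0 //.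
- by move=> /discriminant_B4/root01.
- move=> /discriminant_B5/root01[->|->]; first exact: isomorphic_refl.
  by rewrite -(subrr 1); apply: B5_iso.
Qed.

(** For x = e_2 in B4(a), at least one of x^2 x and x x^2 is a nonzero multiple
of e_3, hence independent of x and x^2. *)
Lemma cubic_all_not_B4 (K : fieldType) (mu : product3 K) (a : K) :
  (forall s t, cubic_condition s t mu) ->
  ~ zariski_closure (orbit3 mu) (structB (B4 a)).
Proof.
move=> mu_st mu_B4.
have /cubic_B4 a0 := closure_cubic (mu_st 1 0) mu_B4.
have /cubic_B4 a1 := closure_cubic (mu_st 0 1) mu_B4.
have /eqP[] := oner_neq0 K.
transitivity ((1 * a + 0 * (a - 1)) - (0 * a + 1 * (a - 1))); first by ring.
by rewrite a0 a1 subrr.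
Qed.

Lemma closure_listed (K : numFieldType) (A : typeC K) (B : typeB K) :
  zariski_closure (orbit3 (structC A)) (structB B) ->
  exists2 B' : typeB K, listed A B' & isomorphic (structB B) (structB B').
Proof.
move=> A_B; have := closure_eigenvalue (structC_eigenvalue A) A_B.
have self B' : listed A B' -> B = B' ->
    exists2 B' : typeB K, listed A B' & isomorphic (structB B) (structB B').
  by move=> A_B' ->; exists B' => //; apply: isomorphic_refl.
have cubic s t : cubic_condition s t (structC A) ->
    if B is B4 a then s * a + t * (a - 1) = 0 else True.
  by case: B A_B {self} => // a A_B /closure_cubic/(_ A_B)/cubic_B4.
have disc0 := fun mu_0 => discriminant0_closure mu_0 A_B.
have not_B4 : (forall s t, cubic_condition s t (structC A)) ->
    if B is B4 _ then False else True.
  case: B A_B {self cubic disc0} => // a A_B all_st.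
  exact: cubic_all_not_B4 all_st A_B.
case: B A_B self cubic disc0 not_B4 => [||| a | b] A_B self cubic disc0 not_B4;
  [by move/B1_eigenvalue|by move/B2_eigenvalue|move=> _..].
- case: A A_B self cubic disc0 not_B4 => [||||a|b|c c0] A_B self _ disc0 _.
  + exact: self (C1_B3 _) _.
  + by case: (disc0 (@C2_discriminant K)).
  + by case: (disc0 (@C3_discriminant K)).
  + by case: (disc0 (@C4_discriminant K)).
  + have /discriminant_B3 d4 := closure_discriminant (C5_discriminant a) A_B.
    (* 1/4 = - a (a + 1) has the double root - 1/2. *)
    have a2 : (a + 1 / 2) ^+ 2 = 0.
      by transitivity (1 / 4 - - (a * (a + 1))); [field | rewrite d4 subrr].
    move/eqP: a2; rewrite sqrf_eq0 addr_eq0 => /eqP a2.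
    by move: self; rewrite a2; apply=> //; apply: C5_Nhalf_B3.
  + have [b1|b1] := eqVneq b (-1); last exact: self (C6_B3 b1) _.
    by move: disc0; rewrite b1 => /(_ (@C6_N1_discriminant K)).
  + by case: (disc0 (C7_discriminant c0)).
- case: A A_B self cubic disc0 not_B4 => [||||b|b|c c0] A_B self cubic _ not_B4.
  + exact: self (C1_B4 a) _.
  + by have := cubic _ _ (@C2_cubic K); rewrite mul1r mul0r addr0 => a0;
      apply: self (C2_B4 _) _; rewrite a0.
  + have := cubic _ _ (@C3_cubic K); rewrite mul0r mul1r add0r => /eqP.
    by rewrite subr_eq0 => /eqP a1; apply: self (C3_B4 _) _; rewrite a1.
  + by have := cubic _ _ (@C4_cubic K); rewrite mul1r mul0r addr0 => a0;
      apply: self (C4_B4 _) _; rewrite a0.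
  + have ab : a = - b.
      apply/eqP; rewrite -addr_eq0 -(cubic _ _ (C5_cubic b)); apply/eqP; ring.
    have [b0|b0] := eqVneq b 0.
      by case: not_B4; rewrite b0; apply: C5_0_cubic.
    have [b1|b1] := eqVneq b (-1).
      by case: not_B4; rewrite b1; apply: C5_N1_cubic.
    have [b2|b2] := eqVneq b (- (1 / 2)); last first.
      by apply: self (C5_B4 b0 b2 b1) _; rewrite ab.
    by move: self; rewrite ab b2 opprK; apply=> //; apply: C5_Nhalf_B4.
  + have [b1|b1] := eqVneq b (-1); last exact: self (C6_B4 a b1) _.
    by case: not_B4; rewrite b1; apply: C6_N1_cubic.
  + have [c1|c1] := eqVneq c (-1).
      move: c0 A_B self cubic not_B4; rewrite c1 => ? _ _ _ notB4.
      by case: notB4 => s t; apply: C7_N1_cubic.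
    by have := cubic _ _ (C7_cubic c0); rewrite mul1r mul0r addr0 => a0;
      apply: self (C7_B4 c0 c1) _; rewrite a0.
- case: A A_B self cubic disc0 not_B4 => [||||a|a|c c0] A_B self _ disc0 _.
  + exact: self (C1_B5 b) _.
  + by exists (B5 0); [exact: C2_B5 | exact/disc0/C2_discriminant].
  + by exists (B5 0); [exact: C3_B5 | exact/disc0/C3_discriminant].
  + by exists (B5 0); [exact: C4_B5 | exact/disc0/C4_discriminant].
  + have C5_d := @C5_discriminant K a.
    have /discriminant_B5 d_b := closure_discriminant C5_d A_B.
    have [a0|a0] := eqVneq a 0.
      exists (B5 0); first by rewrite a0; apply: C5_0_B5.
      by apply: disc0; move: C5_d; rewrite a0 mul0r oppr0.
    have [a1|a1] := eqVneq a (-1).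
      exists (B5 0); first by rewrite a1; apply: C5_N1_B5.
      by apply: disc0; move: C5_d; rewrite a1 addNr mulr0 oppr0.
    (* b (1 - b) = - a (a + 1) has the roots - a and 1 + a = 1 - (- a). *)
    have B5_b : isomorphic (structB (B5 b)) (structB (B5 (- a))).
      have /eqP : (b + a) * (1 - b + a) = 0.
        transitivity (b * (1 - b) - - (a * (a + 1))); first by ring.
        by rewrite d_b subrr.
      rewrite mulf_eq0 !addr_eq0 => /orP[/eqP->|/eqP<-]; last exact: B5_iso.
      exact: isomorphic_refl.
    exists (B5 (- a)) => //; have [a2|a2] := eqVneq a (- (1 / 2)).
      by rewrite a2 opprK; apply: C5_Nhalf_B5.
    exact: C5_B5.
  + have [a1|a1] := eqVneq a (-1); last exact: self (C6_B5 b a1) _.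
    by exists (B5 0); [rewrite a1; apply: C6_N1_B5
                      | apply: disc0; rewrite a1; apply: C6_N1_discriminant].
  + exists (B5 0); last exact/disc0/C7_discriminant.
    have [c1|c1] := eqVneq c (-1); last exact: C7_B5.
    by move: c0 {A_B self disc0}; rewrite c1 => c0; apply: C7_N1_B5.
Qed.

Theorem proposition4p6 (R : realType) (A : typeC R[i]) (B : typeB R[i]) :
  lies_in_boundary (structB B) (structC A) <->
  exists2 B' : typeB R[i], listed A B' & isomorphic (structB B) (structB B').
Proof.
split=> [[nu nu_B [A_nu _]]|[B' A_B' B_B']].
  exact: closure_listed (closure_iso A_nu nu_B).
exists (structB B'); first exact: isomorphic_sym.
split; first exact: listed_closure.
move=> /orbit3P[g g_unit gP].
have := trace_gap_iso (g *m basis3 _ i1) g_unit gP.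
rewrite mulKmx // trace_gap_structB trace_gap_structC mxE => /esym/eqP.
by rewrite oner_eq0.
Qed.
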